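(* Let $V$ be a normed vector space and $X$ a bounded subset of $V$. Then the rectilinear cone $cX$ is uniformly homeomorphic to the cone $CX$ keeping $X$ fixed, i.e. by a uniform homeomorphism sending $(x,0)\in cX$ to the class of $(x,0)$ in $CX$ for each $x\in X$.
   Context: The rectilinear cone $cX\subset V\times\mathbb{R}$ is the union of $X\times\{0\}$, the point $(0,1)$, and all straight line segments joining points of $X\times\{0\}$ with $(0,1)$; it carries the uniformity of a subspace of the normed space $V\times\mathbb{R}$, and $X$ is identified with $X\times\{0\}$. The cone $CX$ is $X\times[0,1]/X\times\{1\}$ with the quotient uniformity, i.e. the finest pre-uniformity making the quotient map from $X\times[0,1]$ uniformly continuous (where $X$ has the uniformity induced from $V$); in it, $X$ is identified with $X\times\{0\}$. *)

(* Defs.v *)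
From HB Require Import structures.
From mathcomp Require Import all_boot all_order all_algebra.
From mathcomp Require Import generic_quotient finmap.
From mathcomp Require Import all_classical all_reals all_analysis.

Set Implicit Arguments.
Unset Strict Implicit.
Unset Printing Implicit Defensive.

Import Order.TTheory GRing.Theory Num.Theory.
Import numFieldNormedType.Exports.

Local Open Scope classical_set_scope.
Local Open Scope quotient_scope.
Local Open Scope ring_scope.

(* A [uniformType] is not required to be separated, so it is what is called a
   pre-uniform space in the literature where uniform spaces are Hausdorff. *)

Definition uniform_homeomorphism (S T : uniformType) (f : S -> T) : Prop :=
  unif_continuous f /\
  exists g : T -> S, [/\ cancel f g, cancel g f & unif_continuous g].

Section collapse.
Variables (Y : choiceType) (A : set Y).

(* The quotient Y/A with the usual convention that Y/set0 is Y plus an isolated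
   point: it is (Y + {None}) / (A + {None}).  When A is nonempty, the extra
   point None is identified with points of Y, and this is the quotient of Y by
   the relation "y = z, or y and z are both in A" (see [collapse_piP] and
   [collapse_pi_surj]). *)
Definition collapsed (o : option Y) : bool :=
  if o is Some y then y \in A else true.

Definition collapse_rel (o p : option Y) : bool :=
  (o == p) || (collapsed o && collapsed p).

Lemma collapse_rel_refl : reflexive collapse_rel.
Proof. by move=> o; rewrite /collapse_rel eqxx. Qed.

Lemma collapse_rel_sym : symmetric collapse_rel.
Proof. by move=> o p; rewrite /collapse_rel eq_sym andbC. Qed.

Lemma collapse_rel_trans : transitive collapse_rel.
Proof.
move=> o p r; rewrite /collapse_rel => /orP[/eqP->//|/andP[cp co]].
by move=> /orP[/eqP<-|/andP[_ cr]]; rewrite cp ?co ?cr orbT.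
Qed.

Canonical collapse_equiv :=
  EquivRel collapse_rel collapse_rel_refl collapse_rel_sym collapse_rel_trans.

Definition collapse := {eq_quot collapse_equiv}.
HB.instance Definition _ := Choice.on collapse.

Definition collapse_pi (y : Y) : collapse := \pi_collapse (Some y).

Lemma collapse_piP (y z : Y) :
  collapse_pi y = collapse_pi z <-> y = z \/ (A y /\ A z).
Proof.
rewrite /collapse_pi; split.
  move=> /eqmodP/= /orP[/eqP[->]|/andP[/set_mem Ay /set_mem Az]]; first by left.
  by right.
move=> h; apply/eqmodP; rewrite /= /collapse_rel /=.
by case: h => [->|[/mem_set -> /mem_set ->]]; rewrite ?eqxx ?orbT.
Qed.

Lemma collapse_pi_surj : A !=set0 -> forall c, exists y, collapse_pi y = c.
Proof.
move=> [a /mem_set Aa] c; rewrite -[c]reprK; case: (repr c) => [y|].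
  by exists y.
by exists a; apply/eqmodP; rewrite /= /collapse_rel /= Aa.
Qed.

End collapse.

Section finest_uniformity.
Variables (Y : uniformType) (T : choiceType) (q : Y -> T).

(* T with the finest pre-uniformity making q uniformly continuous: the
   supremum of all uniform structures for which q is uniformly continuous. *)
Definition finest_uniformity : Type :=
  sup_topology (fun c : {c : Uniform T |
    @unif_continuous Y (Uniform.Pack c) q} => sval c).
HB.instance Definition _ := Uniform.on finest_uniformity.

Lemma finest_unif_continuous :
  @unif_continuous Y finest_uniformity q.
Proof.
move=> E [_ [F _ <-] FE]; rewrite nbhs_simpl /=.
apply: filterS; first by move=> xy; apply: FE.
apply: filter_bigI => -[[i B] /asboolP /= entB] _.
exact: (svalP i) entB.
Qed.

Lemma finest_uniformityP (c : Uniform T) :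
  @unif_continuous Y (Uniform.Pack c) q ->
  @entourage (Uniform.Pack c) `<=` @entourage finest_uniformity.
Proof.
move=> qc E entE; exists E => //.
pose i : {c : Uniform T | @unif_continuous Y (Uniform.Pack c) q} := exist _ c qc.
have entp : `[< @entourage (Uniform.Pack (sval i)) E >] by apply/asboolP.
exists [fset exist (fun p : {classic {c : Uniform T |
    @unif_continuous Y (Uniform.Pack c) q}} * set (T * T) =>
  `[< @entourage (Uniform.Pack (sval p.1)) p.2 >]) (i, E) entp]%fset.
  by move=> ? _; exact: in_setT.
by rewrite set_fset1 bigcap_set1.
Qed.

End finest_uniformity.

Section cone.
Variables (R : realType) (X : uniformType).
Local Notation I := (set_type (`[0, 1]%classic : set R)).

Definition cylinder_top : set (X * I) := [set p | \val p.2 = 1].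

(* CX = X x [0,1] / X x {1}; if X is empty, it consists of the cone vertex. *)
Definition cone : uniformType :=
  finest_uniformity (@collapse_pi (X * I)%type cylinder_top).

Lemma zero_in_I : (0 : R) \in `[0, 1]%classic.
Proof. by apply/mem_set; rewrite /= in_itv/= lexx ler01. Qed.

Definition cone_base (x : X) : cone :=
  collapse_pi cylinder_top (x, exist _ 0 zero_in_I).

End cone.

(* V * R^o is the normed space V x R with the maximum norm; any other standard
   product norm is equivalent to it and induces the same uniformity. *)
Section rectilinear_cone.
Variables (R : realType) (V : normedModType R) (X : set V).

Definition segment (p q : V * R^o) : set (V * R^o) :=
  [set (1 - t) *: p + t *: q | t in `[0, 1]%classic].

Definition rect_cone : set (V * R^o) :=
  X `*` [set 0] `|` [set (0, 1)] `|` \bigcup_(p in X `*` [set 0]) segment p (0, 1).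

Lemma rect_base_subproof (x : X) : (\val x, 0) \in rect_cone.
Proof. by apply/mem_set; left; left; split=> //=; exact: set_valP. Qed.

Definition rect_base (x : X) : rect_cone := exist _ (\val x, 0) (rect_base_subproof x).

End rectilinear_cone.

(* Main.v *)
Require Import Defs.
From mathcomp Require Import all_boot all_order all_algebra.
From mathcomp Require Import generic_quotient.
From mathcomp Require Import all_classical all_reals all_analysis.
From mathcomp Require Import lra.

(** Both cones are images of the cylinder X x [0,1], completed by an extra point
    for the vertex so that the empty X is covered as well: the point (x, t) goes
    to ((1 - t) x, t) in the rectilinear cone and to its class in the quotient
    cone.  The two maps have the same fibres ([cone_pt_eq]), so they determine a
    bijection between the cones, which is the identity on the base.

    Everything about uniformities rests on the identity
    [(1 - t)(x - y) = ((1 - t) x - (1 - s) y) + (t - s) y].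
    As X is bounded, it bounds [(1 - t) x - (1 - s) y] by [x - y] and [t - s];
    so the map from the cylinder to the rectilinear cone is uniformly continuous,
    and then so is the map out of the quotient cone, by the universal property of
    the finest uniformity ([finest_unif_continuous_out]).

    The same identity bounds [(1 - t)(x - y)] in the other direction, which
    controls [x - y] as long as [t] stays away from 1.  Near the vertex this fails,
    but nothing is needed there: if an entourage F of the quotient cone absorbs
    d-close pairs of the cylinder, then every class of height above [1 - d] is
    F-related to the vertex ([near_vertex]), so two such classes are related by
    the composite of F with its inverse.  Choosing two scales, [d] for nearness to
    the vertex and [d / 2] for the distance from it, covers all pairs of nearby
    points ([cone_close]). *)

Set Implicit Arguments.
Unset Strict Implicit.
Unset Printing Implicit Defensive.

Import Order.TTheory GRing.Theory Num.Theory.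
Import numFieldNormedType.Exports.

Local Open Scope classical_set_scope.
Local Open Scope quotient_scope.
Local Open Scope ring_scope.

(** The initial uniformity of [g] makes [q] uniformly continuous, hence is one of
    the uniformities of which the finest one is the supremum. *)
Lemma finest_unif_continuous_out (Y Z : uniformType) (T : choiceType)
    (q : Y -> T) (g : T -> Z) :
  unif_continuous (g \o q) ->
  unif_continuous (g : finest_uniformity q -> Z).
Proof.
move=> gq E entE.
have qc : @unif_continuous Y
    (Uniform.Pack (Uniform.class (initial_topology g))) q.
  move=> F [G entG GF]; have := gq _ entG; rewrite !nbhs_simpl /=.
  by apply: filterS => xy /= Gxy; apply: GF.
by rewrite nbhs_simpl /=; apply: (finest_uniformityP qc); exists E.
Qed.

Section coning_estimates.
Variables (R : realType) (V : normedModType R).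
Implicit Types (x y : V) (s t M : R).

Lemma coningB x y s t :
  (1 - t) *: (x - y) =
  ((1 - t) *: x - (1 - s) *: y) + (t - s) *: y.
Proof.
rewrite -addrA -scaleNr -scalerDl scalerBr -scaleNr; congr (_ + _ *: _).
by lra.
Qed.

Lemma coning_dist_le x y s t M : 0 <= t <= 1 -> `|y| <= M ->
  `|(1 - t) *: x - (1 - s) *: y| <= `|x - y| + M * `|t - s|.
Proof.
move=> /andP[t0 t1] yM.
have -> : (1 - t) *: x - (1 - s) *: y = (1 - t) *: (x - y) - (t - s) *: y.
  by rewrite (coningB x y s t) addrK.
apply: le_trans (ler_normB _ _) _; rewrite !normrZ.
apply: lerD; last by rewrite mulrC ler_wpM2r.
by rewrite ger0_norm ?subr_ge0// ler_piMl// lerBlDr lerDl.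
Qed.

Lemma base_dist_le x y s t M : t <= 1 -> `|y| <= M ->
  (1 - t) * `|x - y| <= `|(1 - t) *: x - (1 - s) *: y| + M * `|t - s|.
Proof.
move=> t1 yM; have <- : `|(1 - t) *: (x - y)| = (1 - t) * `|x - y|.
  by rewrite normrZ ger0_norm ?subr_ge0.
rewrite (coningB x y s t).
apply: le_trans (ler_normD _ _) _; rewrite lerD2l normrZ mulrC.
by rewrite ler_wpM2r.
Qed.

End coning_estimates.

Section cones.
Variables (R : realType) (V : normedModType R) (X : set V).
Local Notation I := (set_type (`[0, 1]%classic : set R)).
Local Notation cyl := (X * I)%type.
Local Notation CX := (collapse (@cylinder_top R X)).

Implicit Types (o p : option cyl) (x y : X) (s t : I).

Lemma I_ge0_le1 t : 0 <= \val t <= 1.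
Proof. by have := set_valP t; rewrite /= in_itv. Qed.

Definition cone_pt o : V * R^o :=
  if o is Some (x, t) then ((1 - \val t) *: \val x, \val t) else (0, 1).

Lemma cone_pt_in o : cone_pt o \in rect_cone X.
Proof.
apply/mem_set; case: o => [[x t]|] /=; last by left; right.
right; exists (\val x, 0); first by split=> //=; exact: set_valP.
exists (\val t); first exact: set_valP.
by congr pair => /=; rewrite scaler0 ?addr0// add0r /GRing.scale/= mulr1.
Qed.

Definition to_rect o : rect_cone X := exist _ (cone_pt o) (cone_pt_in o).

Lemma to_rect_surj (c : rect_cone X) : exists o, to_rect o = c.
Proof.
have [p pc] : exists p, cone_pt p = \val c; last by exists p; exact: val_inj.
have [[[Xp p0]|->]|[p [Xp p0] [t tI <-]]] := set_valP c; last 2 first.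
- by exists None.
- exists (Some (exist _ p.1 (mem_set Xp), exist _ t (mem_set tI))) => /=.
  case: p p0 {Xp} => a b /= ->.
  by congr pair => /=; rewrite scaler0 ?addr0// add0r /GRing.scale/= mulr1.
exists (Some (exist _ (\val c).1 (mem_set Xp) : X,
              exist _ 0 (zero_in_I R) : I)) => /=.
by rewrite subr0 scale1r [RHS]surjective_pairing p0.
Qed.

(** At the common height [t < 1] the factor [1 - t] can be cancelled; height 1
    is the vertex on both sides. *)
Lemma cone_pt_eq o p :
  cone_pt o = cone_pt p <-> collapse_rel (@cylinder_top R X) o p.
Proof.
have topE x t : collapsed (@cylinder_top R X) (Some (x, t)) = (\val t == 1).
  by apply/idP/eqP => [/set_mem|?]; last apply/mem_set.
have topP q : collapsed (@cylinder_top R X) q -> cone_pt q = (0, 1).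
  by case: q => [[x t]|//]; rewrite topE => /eqP /= ->; rewrite subrr scale0r.
split; last by move=> /orP[/eqP->//|/andP[/topP-> /topP->]].
case: o p => [[x t]|] [[y s]|]; rewrite /collapse_rel ?topE//=.
- move=> [+ ts]; rewrite -ts; have [->|t1] := eqVneq (\val t) 1.
    by move=> _; rewrite orbT.
  have u0 : 1 - \val t != 0 by rewrite subr_eq0 eq_sym.
  move=> /(scalerI u0) xy; apply/orP; left; apply/eqP; congr (Some (_, _)).
    exact: val_inj.
  exact: val_inj.
- by move=> [_ ->]; rewrite eqxx.
- by move=> [_ <-]; rewrite eqxx.
Qed.

Lemma to_rect_eq o p : to_rect o = to_rect p <-> \pi_CX o = \pi_CX p.
Proof.
split=> [[/cone_pt_eq op]|/eqmodP /cone_pt_eq op]; first exact/eqmodP.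
exact: val_inj.
Qed.

Definition rect_of_cone (c : cone R X) : rect_cone X := to_rect (repr (c : CX)).

Lemma rect_of_cone_pi o : rect_of_cone (\pi_CX o) = to_rect o.
Proof. by apply/to_rect_eq; rewrite reprK. Qed.

Hypothesis hX : bounded_set X.

Lemma bounded_norm_val : exists2 M : R, 0 < M & forall x, `|\val x| <= M.
Proof.
have [M M0 XM] := pinfty_ex_gt0 hX.
by exists M => // x; apply: XM; exact: set_valP.
Qed.

Lemma unif_continuous_rect_of_cone : unif_continuous rect_of_cone.
Proof.
apply: finest_unif_continuous_out.
have -> : (rect_of_cone : CX -> _) \o collapse_pi (@cylinder_top R X) =
    to_rect \o Some by apply/funext => z /=; exact: rect_of_cone_pi.
have [M M0 XM] := bounded_norm_val.
apply/(@unif_continuousP R) => e e0.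
have d0 : 0 < e / (1 + M) by rewrite divr_gt0// addr_gt0.
exists (e / (1 + M)) => //= -[[x t] [y s]] /= [xyd tsd].
have xy : `|\val x - \val y| < e / (1 + M).
  by move: xyd; rewrite /ball /= /initial_ball -ball_normE.
have ts : `|\val t - \val s| < e / (1 + M).
  by move: tsd; rewrite /ball /= /initial_ball -ball_normE.
suff : ball (cone_pt (Some (x, t))) e (cone_pt (Some (y, s))) by [].
split=> /=; rewrite -ball_normE /=.
  apply: le_lt_trans (coning_dist_le _ _ (I_ge0_le1 t) (XM y)) _.
  have -> : e = e / (1 + M) + M * (e / (1 + M)).
    by rewrite -[X in X + _]mul1r -mulrDl mulrC divfK// gt_eqF// addr_gt0.
  by rewrite ltr_leD// ler_wpM2l// ltW.
apply: lt_le_trans ts _; rewrite ler_pdivrMr ?addr_gt0//.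
by rewrite ler_peMr ?(ltW e0)// lerDl ltW.
Qed.

(** The vertex is the class of (x, 1) for the very [x] of the given point, so only
    the heights have to be compared. *)
Lemma near_vertex (F : set (cone R X * cone R X)) d o :
  0 < d -> entourage F ->
  (forall z w : cyl, ball z d w ->
    F (collapse_pi (@cylinder_top R X) z, collapse_pi (@cylinder_top R X) w)) ->
  1 - d < (cone_pt o).2 -> F (\pi_CX o, \pi_CX None).
Proof.
move=> d0 entF dF; case: o => [[x t]|] /=; last first.
  by move=> _; exact: (@entourage_refl (cone R X)).
move=> td; have one_in : (1 : R) \in `[0, 1]%classic.
  by apply/mem_set; rewrite /= in_itv /= ler01 lexx.
have -> : \pi_CX None = collapse_pi (@cylinder_top R X) (x, exist _ 1 one_in).
  apply/eqmodP; rewrite /= /collapse_rel /=; apply/mem_set.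
  by rewrite /cylinder_top /=.
apply: dF; split; first exact: ballxx.
have /andP[_ t1] := I_ge0_le1 t.
suff : `|\val t - 1| < d by rewrite /ball /= /initial_ball -ball_normE.
rewrite distrC ger0_norm ?subr_ge0// ltrBlDr -ltrBlDl; exact: td.
Qed.

(** This is the uniform continuity of the map from the rectilinear cone to the
    quotient cone, read on representatives. *)
Lemma cone_close (E : set (cone R X * cone R X)) : entourage E ->
  exists2 e : R, 0 < e &
    forall o p, ball (cone_pt o) e (cone_pt p) -> E (\pi_CX o, \pi_CX p).
Proof.
move=> /entourage_split_ex[B entB BE].
pose F := B `&` (B^-1)%relation.
have entF : entourage F by exact: entourage_invI.
have : entourage [set zw : cyl * cyl |
    F (collapse_pi (@cylinder_top R X) zw.1,
       collapse_pi (@cylinder_top R X) zw.2)].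
  exact: (finest_unif_continuous (q := collapse_pi (@cylinder_top R X))).
rewrite -entourage_ballE => -[d /= d0 dF].
have {}dF z w : ball z d w -> F (collapse_pi (@cylinder_top R X) z,
    collapse_pi (@cylinder_top R X) w) by exact: (dF (z, w)).
have [M M0 XM] := bounded_norm_val.
have M1 : 0 < 1 + M by rewrite addr_gt0.
(* For heights at most [1 - d / 2], the second bound turns the estimate
   [(1 - t) * `|x - y| < (1 + M) * e] into [`|x - y| < d]; the first one keeps
   the second height below 1 once the first is at most [1 - d]. *)
pose e := Num.min (d / 2) (d / 2 * d / (1 + M)).
have e0 : 0 < e by rewrite lt_min !(divr_gt0, mulr_gt0).
have ed : e <= d / 2 by rewrite ge_min lexx.
have eM : (1 + M) * e <= d / 2 * d.
  by rewrite mulrC -ler_pdivlMr// ge_min lexx orbT.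
exists e => // o p [].
rewrite -!ball_normE /= => xy ts.
have [|far] := boolP ((1 - d < (cone_pt o).2) && (1 - d < (cone_pt p).2)).
  move=> /andP[no np]; apply: BE; exists (\pi_CX None).
    by have [] := near_vertex d0 entF dF no.
  by have [] := near_vertex d0 entF dF np.
have [tsl tsr] : (cone_pt o).2 - (cone_pt p).2 < d / 2 /\
    (cone_pt p).2 - (cone_pt o).2 < d / 2.
  have := lt_le_trans ts ed; rewrite ltr_norml => /andP[]; lra.
(* One of the heights is at most [1 - d], and they differ by less than [d / 2]. *)
have to : (cone_pt o).2 <= 1 - d / 2.
  by move: far; rewrite negb_and -!leNgt => /orP[]; lra.
suff : F (\pi_CX o, \pi_CX p).
  move=> [Bop _]; apply: BE; exists (\pi_CX p) => //.
  exact: (@entourage_refl (cone R X)).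
(* If [o] or [p] is the vertex, the bounds on the heights are contradictory. *)
move: o p xy ts {far} tsl tsr to.
move=> [[x t]|] [[y s]|] //= xy ts tsl tsr to; try lra.
have tsd : `|\val t - \val s| < d by apply: lt_le_trans ts _; lra.
suff xyd : `|\val x - \val y| < d.
  by apply: dF; split; rewrite /ball /= /initial_ball -ball_normE.
have t1 : \val t <= 1 by have /andP[] := I_ge0_le1 t.
have d2 : 0 < d / 2 by rewrite divr_gt0.
rewrite -(ltr_pM2l d2).
apply: le_lt_trans (_ : (1 - \val t) * `|\val x - \val y| < _).
  rewrite ler_wpM2r// lerBrDr addrC -lerBrDr; exact: to.
apply: le_lt_trans (base_dist_le _ (\val s) t1 (XM y)) _.
apply: lt_le_trans eM; rewrite mulrDl mul1r.
by rewrite ltr_leD// ler_wpM2l// ltW.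
Qed.

End cones.

Theorem lemma11p6 (R : realType) (V : normedModType R) (X : set V)
    (hX : bounded_set X) :
  exists f : rect_cone X -> cone R X,
    uniform_homeomorphism f /\ forall x : X, f (rect_base x) = cone_base R x.
Proof.
pose CX := collapse (@cylinder_top R X).
(* [to_rect] has the same fibres as the projection onto the quotient, so the map
   does not depend on the chosen section [r]. *)
have [r rK] := choice (@to_rect_surj R V X).
exists (fun c => \pi_CX (r c)); split; last first.
  move=> x; apply/to_rect_eq; rewrite rK; apply: val_inj => /=.
  by rewrite subr0 scale1r.
split.
  move=> E entE; have [e e0 eE] := cone_close hX entE.
  rewrite nbhs_simpl -entourage_ballE; exists e => // -[c c'] /= cc'.
  by apply: eE; move: cc'; rewrite -{1}(rK c) -{1}(rK c').
exists (@rect_of_cone R V X).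
split; last exact: unif_continuous_rect_of_cone.
- by move=> c; rewrite rect_of_cone_pi rK.
- move=> c; rewrite -[RHS](reprK (c : CX)); apply/to_rect_eq.
  by rewrite rK.
Qed.
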